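(* Let $G$ be a finitely generated left-orderable group and $X=X^{-1}$ a finite generating set of $G$, and suppose that the Bieri–Neumann–Strebel invariant $\Sigma^1(G)$ is non-empty. Then $G$ admits a positive cone $P$ which spans a connected subgraph of the Cayley graph $\Gamma(G,X)$. In particular, there exist left-orderable (Gromov) hyperbolic groups admitting positive cones that are connected in this sense.
   Context: A positive cone of $G$ is a subsemigroup $P\subseteq G$ with $G=P\sqcup P^{-1}\sqcup\{1\}$; $G$ is left-orderable if it has a positive cone. For a finitely generated group $G$ with finite generating set $X$, a non-trivial homomorphism $\phi:G\to\mathbb{R}$ belongs to $\Sigma^1(G)$ if and only if $\phi^{-1}((0,\infty))$ spans a connected subgraph of $\Gamma(G,X)$ (this does not depend on $X$). *)

(* Defs.v *)
From Stdlib Require Import Reals List.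
Import ListNotations.
Open Scope R_scope.

Record Group := {
  carrier :> Type;
  gmul : carrier -> carrier -> carrier;
  ginv : carrier -> carrier;
  gone : carrier;
  gmulA : forall a b c, gmul a (gmul b c) = gmul (gmul a b) c;
  gmul1l : forall a, gmul gone a = a;
  gmul1r : forall a, gmul a gone = a;
  gmulVl : forall a, gmul (ginv a) a = gone;
  gmulVr : forall a, gmul a (ginv a) = gone
}.

Arguments gmul {G} : rename.
Arguments ginv {G} : rename.
Arguments gone {G} : rename.

Definition word_prod {G : Group} (w : list G) : G := fold_right gmul gone w.

(* X generates G (as a monoid; for symmetric X this is generation as a group). *)
Definition generates {G : Group} (X : list G) : Prop :=
  forall g : G, exists w : list G, (forall x, In x w -> In x X) /\ g = word_prod w.

Definition symmetric_set {G : Group} (X : list G) : Prop :=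
  forall x, In x X -> In (ginv x) X.

Definition positive_cone {G : Group} (P : G -> Prop) : Prop :=
  (forall a b, P a -> P b -> P (gmul a b)) /\
  (forall g : G,
     (P g \/ P (ginv g) \/ g = gone) /\
     ~ (P g /\ P (ginv g)) /\
     ~ (P g /\ g = gone) /\
     ~ (P (ginv g) /\ g = gone)).

Definition left_orderable (G : Group) : Prop :=
  exists P : G -> Prop, positive_cone P.

(* Cayley graph Γ(G,X): vertices G, edges g -- g x for x in X.
   [cayley_conn X S a b]: there is a path from a to b in Γ(G,X) all of whose
   vertices lie in S. *)
Inductive cayley_conn {G : Group} (X : list G) (S : G -> Prop) (a : G) : G -> Prop :=
  | cc_refl : S a -> cayley_conn X S a a
  | cc_step : forall b x, cayley_conn X S a b -> In x X -> S (gmul b x) ->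
              cayley_conn X S a (gmul b x).

Definition spans_connected {G : Group} (X : list G) (S : G -> Prop) : Prop :=
  forall a b, S a -> S b -> cayley_conn X S a b.

Definition is_hom_to_R {G : Group} (phi : G -> R) : Prop :=
  forall g h : G, phi (gmul g h) = phi g + phi h.

Definition in_Sigma1 {G : Group} (X : list G) (phi : G -> R) : Prop :=
  is_hom_to_R phi /\ (exists g, phi g <> 0) /\
  spans_connected X (fun g => 0 < phi g).

(* Main.v *)
(** The positive cone is built lexicographically: [g] is positive when
    [phi g > 0], or when [phi g = 0] and [g] is positive for a given left
    order of [G].  This is a positive cone containing the half-space
    [{phi > 0}], which is connected since [phi] lies in [Σ^1(G)].  Every other
    element [g] of the cone has [phi g = 0], and is joined to that half-space
    by the edge from [g] to [g x], where [x] is a generator with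
    [phi x > 0]; such a generator exists because [phi] is non-zero and [X]
    is symmetric. *)

Require Import Defs.
From Stdlib Require Import Reals List Lra Classical.

Lemma cayley_conn_mono {G : Group} (X : list G) (S T : G -> Prop) a b :
  (forall g, S g -> T g) -> cayley_conn X S a b -> cayley_conn X T a b.
Proof.
  intros HST H; induction H.
  - apply cc_refl; auto.
  - apply cc_step; auto.
Qed.

Lemma cayley_conn_trans {G : Group} (X : list G) S a b c :
  cayley_conn X S a b -> cayley_conn X S b c -> cayley_conn X S a c.
Proof.
  intros Hab Hbc; induction Hbc.
  - exact Hab.
  - apply cc_step; auto.
Qed.

Lemma cayley_conn_edge {G : Group} (X : list G) (S : G -> Prop) a x :
  In x X -> S a -> S (gmul a x) -> cayley_conn X S a (gmul a x).
Proof. intros HxX Ha Hax; apply cc_step; [apply cc_refl| |]; auto. Qed.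

Lemma cayley_conn_edge_inv {G : Group} (X : list G) (S : G -> Prop) a x :
  symmetric_set X -> In x X -> S a -> S (gmul a x) ->
  cayley_conn X S (gmul a x) a.
Proof.
  intros hsym HxX Ha Hax.
  assert (Eback : gmul (gmul a x) (ginv x) = a)
    by (rewrite <- gmulA, gmulVr, gmul1r; reflexivity).
  rewrite <- Eback at 2.
  apply cayley_conn_edge; [apply hsym; exact HxX | exact Hax | now rewrite Eback].
Qed.

Section HomToR.

Variables (G : Group) (phi : G -> R).
Hypothesis phi_hom : is_hom_to_R phi.

Lemma hom_one : phi gone = 0.
Proof. pose proof (phi_hom gone gone) as E; rewrite gmul1l in E; lra. Qed.

Lemma hom_inv (g : G) : phi (ginv g) = - phi g.
Proof. pose proof (phi_hom (ginv g) g) as E; rewrite gmulVl, hom_one in E; lra. Qed.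

Lemma hom_word_prod_eq0 (w : list G) :
  (forall x, In x w -> phi x = 0) -> phi (word_prod w) = 0.
Proof.
  induction w as [|y w IHw]; intros Hw; simpl.
  - exact hom_one.
  - rewrite phi_hom, (Hw y (or_introl eq_refl)), IHw; [lra|].
    intros z Hz; apply Hw; right; exact Hz.
Qed.

Lemma exists_generator_hom_pos (X : list G) :
  generates X -> symmetric_set X -> (exists g, phi g <> 0) ->
  exists x, In x X /\ 0 < phi x.
Proof.
  intros hgen hsym [g Hg].
  apply NNPP; intros Hnone.
  assert (HX0 : forall x, In x X -> phi x = 0).
  { intros x HxX.
    assert (~ 0 < phi x) by (intro; apply Hnone; eauto).
    assert (~ 0 < phi (ginv x)) by (intro; apply Hnone; eauto using hsym).
    rewrite hom_inv in *; lra. }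
  destruct (hgen g) as [w [HwX ->]].
  apply Hg, hom_word_prod_eq0; auto.
Qed.

Definition lex_cone (Q : G -> Prop) (g : G) : Prop :=
  0 < phi g \/ (phi g = 0 /\ Q g).

Lemma lex_cone_positive_cone (Q : G -> Prop) :
  positive_cone Q -> positive_cone (lex_cone Q).
Proof.
  intros [HQmul HQtri]; unfold lex_cone; split.
  - intros a b Ha Hb; rewrite phi_hom.
    destruct Ha as [Ha|[Ha Qa]], Hb as [Hb|[Hb Qb]]; try (left; lra).
    right; split; [lra | auto].
  - intros g; rewrite hom_inv.
    destruct (HQtri g) as [Htri [Hasym [Hne1 Hne1']]].
    repeat split.
    + destruct (Rtotal_order (phi g) 0) as [Hlt|[Heq|Hgt]].
      * right; left; left; lra.
      * destruct Htri as [T|[T|T]]; auto.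
        right; left; right; split; [lra | exact T].
      * left; left; exact Hgt.
    + intros [[A|[A QA]] [B|[B QB]]]; try lra; auto.
    + intros [[A|[A QA]] ->]; [rewrite hom_one in A; lra | auto].
    + intros [[A|[A QA]] ->]; [rewrite hom_one in A; lra | auto].
Qed.

Lemma lex_cone_spans_connected (X : list G) (Q : G -> Prop) (x : G) :
  symmetric_set X -> In x X -> 0 < phi x ->
  spans_connected X (fun g => 0 < phi g) -> spans_connected X (lex_cone Q).
Proof.
  intros hsym HxX Hx Hconn.
  assert (Hhalf : forall a b, 0 < phi a -> 0 < phi b ->
                  cayley_conn X (lex_cone Q) a b).
  { intros a b Ha Hb; apply (cayley_conn_mono X (fun g => 0 < phi g)).
    - intros g Hg; left; exact Hg.
    - apply Hconn; assumption. }
  assert (Hlift : forall a, lex_cone Q a -> 0 < phi (gmul a x) \/ 0 < phi a).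
  { intros a [Ha|[Ha _]]; [right | left; rewrite phi_hom]; lra. }
  intros a b Ha Hb.
  destruct (Hlift a Ha) as [Hax|Ha'], (Hlift b Hb) as [Hbx|Hb'].
  - apply (cayley_conn_trans _ _ _ (gmul a x));
      [apply cayley_conn_edge; auto; left; exact Hax|].
    apply (cayley_conn_trans _ _ _ (gmul b x)); [apply Hhalf; assumption|].
    apply cayley_conn_edge_inv; auto; left; exact Hbx.
  - apply (cayley_conn_trans _ _ _ (gmul a x));
      [apply cayley_conn_edge; auto; left; exact Hax|].
    apply Hhalf; assumption.
  - apply (cayley_conn_trans _ _ _ (gmul b x)); [apply Hhalf; assumption|].
    apply cayley_conn_edge_inv; auto; left; exact Hbx.
  - apply Hhalf; assumption.
Qed.

End HomToR.

Theorem proposition1p3 (G : Group) (X : list G)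
  (hgen : generates X) (hsym : symmetric_set X)
  (hlo : left_orderable G)
  (hSigma : exists phi : G -> R, in_Sigma1 X phi) :
  exists P : G -> Prop, positive_cone P /\ spans_connected X P.
Proof.
  destruct hlo as [Q HQ].
  destruct hSigma as [phi [Hhom [Hnz Hconn]]].
  destruct (exists_generator_hom_pos G phi Hhom X hgen hsym Hnz) as [x [HxX Hx]].
  exists (lex_cone G phi Q); split.
  - apply lex_cone_positive_cone; assumption.
  - apply (lex_cone_spans_connected G phi Hhom X Q x); assumption.
Qed.
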